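(* Let $u:\mathbb{T}\to\mathbb{S}$ be a functor, $\varphi_\alpha: S\to S_\alpha$ a family in $\mathbb{S}$, $f_\alpha: Y_\alpha\to X_\alpha$ arrows of $\mathbb{T}$ with $f_\alpha$ over $\varphi_\alpha$ for each $\alpha$, $\pi_\alpha: X\to Y_\alpha$ a family of arrows in the fiber $\mathbb{T}_S$, and $p_\alpha=f_\alpha\circ\pi_\alpha: X\to X_\alpha$ (a family over $\varphi_\alpha$). (i) If each arrow $f_\alpha$ is cartesian, then $\pi_\alpha$ is a product (cone) in $\mathbb{T}_S$ if and only if $p_\alpha$ is a cartesian family. (ii) If each arrow $f_\alpha$ is initial, then $\pi_\alpha$ is an initial family if and only if $p_\alpha$ is an initial family.
   Context: Families of arrows are allowed to be large (indexed by arbitrary classes) and may be empty. Given $u:\mathbb{T}\to\mathbb{S}$, objects, arrows and families of $\mathbb{T}$ sit over their images under $u$; $\mathbb{T}_S$ is the fiber over $S$ (arrows of $\mathbb{T}$ sitting over $id_S$). A family $h_\alpha: A\to A_\alpha$ over $\varphi_\alpha: S\to S_\alpha$ is ($u$-)cartesian if for any family $g_\alpha: B\to A_\alpha$ over the same $\varphi_\alpha: S\to S_\alpha$ there is a unique $g: B\to A$ in $\mathbb{T}_S$ with $h_\alpha g=g_\alpha$ for all $\alpha$. It is ($u$-)initial if for any family $g_\alpha: B\to A_\alpha$ in $\mathbb{T}$ and any arrow $\varphi: R\to S$ in $\mathbb{S}$ such that $g_\alpha$ sits over $\varphi_\alpha\circ\varphi$ for all $\alpha$ (with $B$ over $R$),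 there is a unique $g: B\to A$ over $\varphi$ with $h_\alpha g=g_\alpha$ for all $\alpha$. A cartesian (resp. initial) arrow is a one-element cartesian (resp. initial) family. *)

(* Defs.v *)
From Stdlib Require Import ProofIrrelevance.

Set Implicit Arguments.
Unset Strict Implicit.
Unset Printing Implicit Defensive.

Declare Scope cat_scope.
Delimit Scope cat_scope with cat.
Open Scope cat_scope.

(* Neither objects nor hom-types are subject to any size restriction. *)
Record category := Category {
  ob :> Type;
  hom : ob -> ob -> Type;
  idm : forall A, hom A A;
  comp : forall A B C, hom B C -> hom A B -> hom A C;
  comp_idl : forall A B (f : hom A B), comp (idm B) f = f;
  comp_idr : forall A B (f : hom A B), comp f (idm A) = f;
  comp_assoc : forall A B C D (h : hom C D) (g : hom B C) (f : hom A B),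
    comp h (comp g f) = comp (comp h g) f
}.
Arguments hom {c} _ _.
Arguments idm {c} _.
Arguments comp {c A B C} _ _.

Notation "g ∘ f" := (comp g f) (at level 40, left associativity) : cat_scope.

Record functor (T S : category) := Functor {
  fob :> T -> S;
  fmap : forall A B : T, hom A B -> hom (fob A) (fob B);
  fmap_id : forall A : T, fmap (idm A) = idm (fob A);
  fmap_comp : forall (A B C : T) (g : hom B C) (f : hom A B),
    fmap (g ∘ f) = fmap g ∘ fmap f
}.
Arguments fmap {T S} _ {A B} _.

(* An arrow sits over phi : R -> R' when its image under u, domain and
   codomain included, is phi. The end points R and R' are only
   propositionally equal to the images of those of g, so this equality of
   arrows is rendered as an indexed family. *)
Inductive sits_over (T S : category) (u : functor T S) (B A : T) (g : hom B A) :
    forall R R' : S, hom R R' -> Prop :=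
  sits_over_image : sits_over u g (fmap u g).
Arguments sits_over {T S} u {B A} g {R R'} _.

Lemma sits_overP (T S : category) (u : functor T S) (B A : T) (g : hom B A)
    (R R' : S) (phi : hom R R') :
  sits_over u g phi <->
  exists (eB : u B = R) (eA : u A = R'),
    eq_rect _ (fun Q => hom R Q)
      (eq_rect _ (fun Q => hom Q (u A)) (fmap u g) _ eB) _ eA = phi.
Proof.
split.
- intros []. now exists eq_refl, eq_refl.
- intros (eB & eA & e). destruct eB, eA, e. constructor.
Qed.

Lemma sits_over_id (T S : category) (u : functor T S) (A : T) (R : S) :
  u A = R -> sits_over u (idm A) (idm R).
Proof. intros []. rewrite <- fmap_id. constructor. Qed.

Lemma sits_over_comp (T S : category) (u : functor T S) (A B C : T)
    (g : hom B C) (f : hom A B) (P Q R : S) (psi : hom Q R) (phi : hom P Q) :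
  sits_over u g psi -> sits_over u f phi -> sits_over u (g ∘ f) (psi ∘ phi).
Proof.
intros Hg Hf.
apply sits_overP in Hg; destruct Hg as (eB & eC & <-).
apply sits_overP in Hf; destruct Hf as (eA & eB' & <-).
destruct eA, eC, eB.
rewrite (proof_irrelevance _ eB' eq_refl); simpl.
rewrite <- fmap_comp. constructor.
Qed.

Section Fiber.
Variables (T S : category) (u : functor T S) (Q : S).

Record fiber_ob := FiberOb { fval : T; fvalP : u fval = Q }.

Record fiber_hom (A B : fiber_ob) := FiberHom {
  farr : hom (fval A) (fval B);
  farrP : sits_over u farr (idm Q)
}.

Lemma fiber_hom_eq (A B : fiber_ob) (f g : fiber_hom A B) :
  farr f = farr g -> f = g.
Proof.
destruct f as [f Hf], g as [g Hg]; simpl; intros <-.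
now rewrite (proof_irrelevance _ Hf Hg).
Qed.

Definition fiber_id (A : fiber_ob) : fiber_hom A A :=
  FiberHom (sits_over_id (fvalP A)).

Lemma fiber_compP (A B C : fiber_ob) (g : fiber_hom B C) (f : fiber_hom A B) :
  sits_over u (farr g ∘ farr f) (idm Q).
Proof.
rewrite <- (comp_idl (idm Q)).
exact (sits_over_comp (farrP g) (farrP f)).
Qed.

Definition fiber_comp (A B C : fiber_ob) (g : fiber_hom B C)
    (f : fiber_hom A B) : fiber_hom A C :=
  FiberHom (fiber_compP g f).

Definition fiber : category.
Proof.
refine (@Category fiber_ob fiber_hom fiber_id fiber_comp _ _ _);
  intros; apply fiber_hom_eq; simpl.
- apply comp_idl.
- apply comp_idr.
- apply comp_assoc.
Defined.

End Fiber.

Definition is_product (C : category) (I : Type) (X : C) (Y : I -> C)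
    (pi : forall a, hom X (Y a)) : Prop :=
  forall (B : C) (g : forall a, hom B (Y a)),
    exists! k : hom B X, forall a, pi a ∘ k = g a.
Arguments is_product {C I X Y} pi.

Section Families.
Variables (T S : category) (u : functor T S).

(* The first conjunct matters only for empty families, where it is the sole
   link between the common domain A and Q. *)
Definition family_over (I : Type) (Q : S) (Qs : I -> S)
    (phi : forall a, hom Q (Qs a)) (A : T) (As : I -> T)
    (h : forall a, hom A (As a)) : Prop :=
  u A = Q /\ forall a, sits_over u (h a) (phi a).

Definition cartesian_family (I : Type) (Q : S) (Qs : I -> S)
    (phi : forall a, hom Q (Qs a)) (A : T) (As : I -> T)
    (h : forall a, hom A (As a)) : Prop :=
  family_over phi h /\
  forall (B : T) (g : forall a, hom B (As a)), family_over phi g ->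
    exists! k : hom B A, sits_over u k (idm Q) /\ forall a, h a ∘ k = g a.

Definition initial_family (I : Type) (Q : S) (Qs : I -> S)
    (phi : forall a, hom Q (Qs a)) (A : T) (As : I -> T)
    (h : forall a, hom A (As a)) : Prop :=
  family_over phi h /\
  forall (R : S) (psi : hom R Q) (B : T) (g : forall a, hom B (As a)),
    family_over (fun a => phi a ∘ psi) g ->
    exists! k : hom B A, sits_over u k psi /\ forall a, h a ∘ k = g a.

Definition cartesian_arrow (Q Q' : S) (phi : hom Q Q') (A A' : T)
    (h : hom A A') : Prop :=
  cartesian_family (fun _ : unit => phi) (fun _ : unit => h).

Definition initial_arrow (Q Q' : S) (phi : hom Q Q') (A A' : T)
    (h : hom A A') : Prop :=
  initial_family (fun _ : unit => phi) (fun _ : unit => h).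

End Families.

Arguments family_over {T S} u {I Q Qs} phi {A As} h.
Arguments cartesian_family {T S} u {I Q Qs} phi {A As} h.
Arguments initial_family {T S} u {I Q Qs} phi {A As} h.
Arguments cartesian_arrow {T S} u {Q Q'} phi {A A'} h.
Arguments initial_arrow {T S} u {Q Q'} phi {A A'} h.

(* Main.v *)
(** For a fixed [psi : R -> Q], say that a family has lifts over [psi] when it
    has the universal property of an initial family restricted to this [psi].
    Composing with arrows [f a] that have lifts over [psi] does not affect this
    property: lifts through [f a ∘ pi a] are obtained by lifting first through
    each [f a], then through [pi].  Cartesian means having lifts over the
    identity, initial means having lifts over every [psi], and a family in a
    fiber is a product exactly when it has lifts over the identity. *)

From Stdlib Require Import IndefiniteDescription.
Require Import Defs.

Set Implicit Arguments.
Unset Strict Implicit.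

(** Serves to assemble the lifts through the separate [f a] into one family. Their existence is a
    [Prop] while arrows live in a [Type], so indefinite description is used to extract them. *)
Lemma dependent_unique_choice (I : Type) (A : I -> Type)
    (P : forall a, A a -> Prop) :
  (forall a, exists! x, P a x) -> exists s : forall a, A a, forall a, P a (s a).
Proof.
intros H.
assert (w : forall a, {x | P a x}).
{ intros a. apply constructive_indefinite_description.
  destruct (H a) as (x & Hx & _). now exists x. }
exists (fun a => proj1_sig (w a)). intros a. exact (proj2_sig (w a)).
Qed.

Section Lifts.
Variables (T S : category) (u : functor T S).

Definition has_lifts (I : Type) (Q : S) (Qs : I -> S)
    (phi : forall a, hom Q (Qs a)) (A : T) (As : I -> T)
    (h : forall a, hom A (As a)) (R : S) (psi : hom R Q) : Prop :=
  forall (B : T) (g : forall a, hom B (As a)),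
    family_over u (fun a => phi a ∘ psi) g ->
    exists! k : hom B A, sits_over u k psi /\ forall a, h a ∘ k = g a.

Lemma family_over_comp_id (I : Type) (Q : S) (Qs : I -> S)
    (phi : forall a, hom Q (Qs a)) (A : T) (As : I -> T)
    (h : forall a, hom A (As a)) :
  family_over u (fun a => phi a ∘ idm Q) h <-> family_over u phi h.
Proof.
split; intros [e H]; split; trivial; intros a; specialize (H a);
  now rewrite comp_idr in *.
Qed.

Lemma cartesian_familyE (I : Type) (Q : S) (Qs : I -> S)
    (phi : forall a, hom Q (Qs a)) (A : T) (As : I -> T)
    (h : forall a, hom A (As a)) :
  cartesian_family u phi h <->
  family_over u phi h /\ has_lifts phi h (idm Q).
Proof.
split; intros [Hh H]; split; trivial; intros B g Hg;
  now apply H, family_over_comp_id.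
Qed.

Lemma initial_familyE (I : Type) (Q : S) (Qs : I -> S)
    (phi : forall a, hom Q (Qs a)) (A : T) (As : I -> T)
    (h : forall a, hom A (As a)) :
  initial_family u phi h <->
  family_over u phi h /\ forall (R : S) (psi : hom R Q), has_lifts phi h psi.
Proof. reflexivity. Qed.

Lemma has_lifts_arrow (Q Q' R : S) (phi : hom Q Q') (A A' : T) (h : hom A A')
    (psi : hom R Q) :
  has_lifts (fun _ : unit => phi) (fun _ : unit => h) psi ->
  forall (B : T) (g : hom B A'), u B = R -> sits_over u g (phi ∘ psi) ->
    exists! k : hom B A, sits_over u k psi /\ h ∘ k = g.
Proof.
intros H B g e Hg.
destruct (H B (fun _ => g)) as (k & [Hk E] & U); [now split|].
exists k; split; [now split; [|apply (E tt)]|].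
intros k' [Hk' E']. now apply U.
Qed.

(** Both [k] and [k'] are lifts of [h ∘ k], so uniqueness identifies them. This allows each [f a] to
    be cancelled on the left among arrows over [psi]. *)
Lemma has_lifts_arrow_inj (Q Q' R : S) (phi : hom Q Q') (A A' : T)
    (h : hom A A') (psi : hom R Q) :
  has_lifts (fun _ : unit => phi) (fun _ : unit => h) psi ->
  sits_over u h phi ->
  forall (B : T) (k k' : hom B A), u B = R ->
    sits_over u k psi -> sits_over u k' psi -> h ∘ k = h ∘ k' -> k = k'.
Proof.
intros H Hh B k k' e Hk Hk' E.
destruct (has_lifts_arrow H e (sits_over_comp Hh Hk)) as (l & _ & U).
transitivity l; [symmetry|]; apply U; now split.
Qed.

Section Composition.
Variables (I : Type) (Q : S) (Qs : I -> S) (phi : forall a, hom Q (Qs a)).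
Variables (X : T) (Y Xs : I -> T) (f : forall a, hom (Y a) (Xs a)).
Variable pi : forall a, hom X (Y a).
Hypothesis f_over : forall a, sits_over u (f a) (phi a).
Hypothesis pi_over : forall a, sits_over u (pi a) (idm Q).

Lemma has_lifts_comp (R : S) (psi : hom R Q) :
  (forall a, has_lifts (fun _ : unit => phi a) (fun _ : unit => f a) psi) ->
  has_lifts (fun _ : I => idm Q) pi psi <->
  has_lifts phi (fun a => f a ∘ pi a) psi.
Proof.
intros Hf.
(* Gives [auto] the side condition for cancelling [f a] in front of [pi a ∘ k]. *)
assert (piP : forall (B : T) (k : hom B X),
  sits_over u k psi -> forall a, sits_over u (pi a ∘ k) psi).
{ intros B k Hk a. rewrite <- (comp_idl psi).
  exact (sits_over_comp (pi_over a) Hk). }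
split; intros H B g [e Hg].
(* Here [k a] is the lift of [g a] through [f a], and [l] the lift of the family [k] through
   [pi]. *)
- destruct (dependent_unique_choice
    (fun a => has_lifts_arrow (Hf a) e (Hg a))) as (k & Hk).
  destruct (H B k) as (l & [Hl El] & U).
  { split; trivial. intros a. rewrite comp_idl. apply Hk. }
  exists l; split.
  + split; trivial. intros a. rewrite <- comp_assoc, El. apply Hk.
  (* Any competitor [l'] also lifts [k]: [pi a ∘ l'] and [k a] agree after composition with
     [f a]. *)
  + intros l' [Hl' El']. apply U. split; trivial. intros a.
    apply (has_lifts_arrow_inj (Hf a) (f_over a) e); auto; [apply Hk|].
    rewrite comp_assoc, El'. symmetry. apply Hk.
- assert (Hg' : forall a, sits_over u (g a) psi).
  { intros a. rewrite <- (comp_idl psi). apply Hg. }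
  (* Conversely, push the test family [g] forward along the [f a], lift the result, then cancel
     [f a]. *)
  destruct (H B (fun a => f a ∘ g a)) as (l & [Hl El] & U).
  { split; trivial. intros a. exact (sits_over_comp (f_over a) (Hg' a)). }
  exists l; split.
  + split; trivial. intros a.
    apply (has_lifts_arrow_inj (Hf a) (f_over a) e); auto.
    now rewrite comp_assoc.
  + intros l' [Hl' El']. apply U. split; trivial. intros a.
    now rewrite <- comp_assoc, El'.
Qed.

End Composition.

(** The conjunct [u B = Q] of [family_over] makes the domain of a test family an object of the
    fiber, even for empty [I]. Arrows over [idm Q] are then fiber arrows, determined by their
    underlying arrow through [fiber_hom_eq]. *)
Lemma is_productE (I : Type) (Q : S) (X : fiber u Q) (Y : I -> fiber u Q)
    (pi : forall a, hom X (Y a)) :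
  is_product pi <->
  has_lifts (fun _ : I => idm Q) (fun a => farr (pi a)) (idm Q).
Proof.
split; intros H B g.
- intros Hg. apply -> family_over_comp_id in Hg. destruct Hg as [e Hg].
  pose (B' := FiberOb e).
  destruct (H B' (fun a => FiberHom (A := B') (B := Y a) (Hg a)))
    as (k & Hk & U).
  exists (farr k); split.
  + split; [exact (farrP k)|]. intros a.
    exact (f_equal (fun m => farr m) (Hk a)).
  + intros k' [Hk' E].
    refine (f_equal (fun m => farr m) (U (FiberHom (A := B') (B := X) Hk') _)).
    intros a. apply fiber_hom_eq, E.
- destruct (H (fval B) (fun a => farr (g a))) as (k & [Hk E] & U).
  { apply <- family_over_comp_id. split; [exact (fvalP B)|].
    intros a. exact (farrP (g a)). }
  exists (FiberHom Hk); split.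
  + intros a. apply fiber_hom_eq, E.
  + intros k' E'. apply fiber_hom_eq, U. split; [exact (farrP k')|].
    intros a. exact (f_equal (fun m => farr m) (E' a)).
Qed.

End Lifts.

Theorem lemma3p8 (T S : category) (u : functor T S) (I : Type)
  (Q : S) (Qs : I -> S) (phi : forall a : I, hom Q (Qs a))
  (X : fiber u Q) (Y : I -> fiber u Q) (Xs : I -> T)
  (f : forall a : I, hom (fval (Y a)) (Xs a))
  (f_over : forall a : I, sits_over u (f a) (phi a))
  (pi : forall a : I, hom X (Y a)) :
  ((forall a : I, cartesian_arrow u (phi a) (f a)) ->
    (is_product pi <->
     cartesian_family u phi (fun a : I => f a ∘ farr (pi a)))) /\
  ((forall a : I, initial_arrow u (phi a) (f a)) ->
    (initial_family u (fun a : I => idm Q) (fun a : I => farr (pi a)) <->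
     initial_family u phi (fun a : I => f a ∘ farr (pi a)))).
Proof.
assert (pi_over : forall a, sits_over u (farr (pi a)) (idm Q)).
{ intros a. exact (farrP (pi a)). }
(* Both [family_over] conditions hold outright, which leaves only the lifting properties to
   compare. *)
assert (Fpi : family_over u (fun a : I => idm Q) (fun a => farr (pi a))).
{ split; [exact (fvalP X)|exact pi_over]. }
assert (Fp : family_over u phi (fun a => f a ∘ farr (pi a))).
{ apply family_over_comp_id. split; [exact (fvalP X)|].
  intros a. exact (sits_over_comp (f_over a) (pi_over a)). }
split; intros Hf.
- rewrite is_productE, cartesian_familyE, (has_lifts_comp f_over pi_over).
  + tauto.
  + intros a. exact (proj2 (proj1 (cartesian_familyE _ _ _) (Hf a))).
- rewrite !initial_familyE.
  (* Part (i) used only [psi = idm Q]; initiality of the [f a] gives the equivalence for each [psi]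
     separately. *)
  assert (E : forall (R : S) (psi : hom R Q),
    has_lifts u (fun _ : I => idm Q) (fun a => farr (pi a)) psi <->
    has_lifts u phi (fun a => f a ∘ farr (pi a)) psi).
  { intros R psi. apply (has_lifts_comp f_over pi_over).
    intros a. exact (proj2 (Hf a) R psi). }
  split; intros [_ H]; split; trivial; intros R psi; apply E, H.
Qed.
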